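(* Let $n,k$ be integers with $1\le k\le n-1$, let $r_1\ge\cdots\ge r_n\ge0$ be real numbers, and let $R_0=\sum_{i=1}^n r_i$. The value $V$ of the booby trap search game with $n$ boxes, rewards $r_1,\dots,r_n$ and $k$ booby traps on the complete hypergraph on $[n]$ satisfies $$V\le\frac{R_0}{k+1}\left(1-\frac1{k+1}\right)^k.$$
   Context: The booby trap search game: there are $n$ boxes, identified with the vertex set $[n]=\{1,\dots,n\}$ of a hypergraph $G$ with set of hyperedges $E\subseteq 2^{[n]}$. Box $i$ contains a reward $r_i$. A Hider pure strategy is a set $H\subseteq[n]$ with $|H|=k$ (the booby trapped boxes). A Searcher pure strategy is a hyperedge $S\in E$ (the boxes opened). The payoff (to the maximizing Searcher, in a zero-sum game against the minimizing Hider) is $R(S,H)=\sum_{i\in S}r_i$ if $S\cap H=\emptyset$, and $R(S,H)=0$ otherwise. Mixed strategies are probability distributions over pure strategies, and payoffs extend by expectation. The value is in the usual sense for finite two-person zero-sum games. In the complete hypergraph, $E=2^{[n]}$, so the Searcher may open any subset of $[n]$. *)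

(* Defs.v *)
From HB Require Import structures.
From mathcomp Require Import all_boot all_order all_algebra.
From mathcomp Require Import reals.

Set Implicit Arguments.
Unset Strict Implicit.
Unset Printing Implicit Defensive.

Import Order.TTheory GRing.Theory Num.Theory.
Local Open Scope ring_scope.

(* A mixed strategy over the set A of pure strategies is encoded as a
   probability mass function on the ambient finite type vanishing off A. *)
Definition mixed_strategy (R : realType) (T : finType) (A : {set T})
    (p : {ffun T -> R}) : Prop :=
  [/\ forall x, 0 <= p x,
      forall x, x \notin A -> p x = 0
    & \sum_x p x = 1].

Definition expected_payoff (R : realType) (X Y : finType) (u : X -> Y -> R)
    (p : {ffun X -> R}) (q : {ffun Y -> R}) : R :=
  \sum_x \sum_y p x * q y * u x y.

(* V is the value of the finite zero-sum game in which the maximizer has pure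
   strategies A, the minimizer has pure strategies B, and u is the payoff to
   the maximizer: the maximizer can guarantee at least V and the minimizer can
   guarantee at most V, i.e. max_p min_q = V = min_q max_p over mixed
   strategies.  Such a V is unique, and it exists by von Neumann's minimax
   theorem as soon as A and B are nonempty. *)
Definition is_game_value (R : realType) (X Y : finType)
    (A : {set X}) (B : {set Y}) (u : X -> Y -> R) (V : R) : Prop :=
  (exists2 p : {ffun X -> R}, mixed_strategy A p &
     forall q : {ffun Y -> R}, mixed_strategy B q ->
       V <= expected_payoff u p q) /\
  (exists2 q : {ffun Y -> R}, mixed_strategy B q &
     forall p : {ffun X -> R}, mixed_strategy A p ->
       expected_payoff u p q <= V).

Lemma is_game_value_unique (R : realType) (X Y : finType)
    (A : {set X}) (B : {set Y}) (u : X -> Y -> R) (V W : R) :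
  is_game_value A B u V -> is_game_value A B u W -> V = W.
Proof.
move=> [[p1 mp1 hp1] [q1 mq1 hq1]] [[p2 mp2 hp2] [q2 mq2 hq2]].
apply/eqP; rewrite eq_le; apply/andP; split.
- exact: le_trans (hp1 q2 mq2) (hq2 p1 mp1).
- exact: le_trans (hp2 q1 mq1) (hq1 p2 mp2).
Qed.

(* Box i of [n] = {1, ..., n} is represented by the ordinal i - 1 : 'I_n. *)
Definition trap_payoff (R : realType) (n : nat) (r : 'I_n -> R)
    (S H : {set 'I_n}) : R :=
  if [disjoint S & H] then \sum_(i in S) r i else 0.

Definition hider_strategies (n k : nat) : {set {set 'I_n}} :=
  [set H : {set 'I_n} | #|H| == k].

Definition complete_hypergraph (n : nat) : {set {set 'I_n}} :=
  [set: {set 'I_n}].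

Definition is_trap_game_value (R : realType) (n k : nat)
    (E : {set {set 'I_n}}) (r : 'I_n -> R) (V : R) : Prop :=
  is_game_value E (hider_strategies n k) (trap_payoff r) V.

(* Main.v *)
(* The Hider draws k boxes independently with replacement, box i with
   probability r_i / R_0, and completes the set of drawn boxes to a k-set.
   A Searcher set S of total probability x earns R_0 x and avoids all traps
   with probability at most (1 - x)^k, and x (1 - x)^k is maximal at
   x = 1 / (k + 1). *)
Require Import Defs.
From HB Require Import structures.
From mathcomp Require Import all_boot all_order all_algebra.
From mathcomp Require Import reals.

Set Implicit Arguments.
Unset Strict Implicit.

Import Order.TTheory GRing.Theory Num.Theory.
Local Open Scope ring_scope.

Lemma exists_superset_card (T : finType) (k : nat) (A : {set T}) :
  (#|A| <= k <= #|T|)%N -> exists2 B : {set T}, A \subset B & #|B| == k.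
Proof.
case/andP=> /subnK <-; move: (k - #|A|)%N => d.
elim: d A => [|d IHd] A hA.
  by exists A; rewrite ?subxx.
have [x xA] : exists x, x \notin A.
  apply/existsP; rewrite -negb_forall; apply: contraL hA => /forallP allA.
  rewrite -ltnNge addSn ltnS -cardsT (_ : setT = A) ?leq_addl //.
  by apply/setP => y; rewrite inE allA.
have cardxA : #|x |: A| = #|A|.+1 by rewrite cardsU1 xA.
have [|B sB cB] := IHd (x |: A); first by rewrite cardxA addnS -addSn.
exists B; first exact: subset_trans (subsetUr _ _) sB.
by rewrite (eqP cB) cardxA addnS addSn.
Qed.

(** Normalising by the total breaks down when it is 0; then every [r i] vanishes and uniform weights
    do. The product form of the last clause covers both cases at once. *)
Lemma exists_weights (R : realFieldType) (I : finType) (r : I -> R) :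
  (0 < #|I|)%N -> (forall i, 0 <= r i) ->
  exists P : I -> R, [/\ forall i, 0 <= P i, \sum_i P i = 1
    & forall i, r i = (\sum_j r j) * P i].
Proof.
move=> I_gt0 r_ge0; have [r0|rN0] := eqVneq (\sum_j r j) 0.
  exists (fun=> #|I|%:R^-1); split=> [i||i]; first by rewrite invr_ge0 ler0n.
    by rewrite sumr_const -[LHS]mulr_natr mulVf // pnatr_eq0 -lt0n.
  rewrite r0 mul0r; apply/eqP; move/eqP: r0; rewrite psumr_eq0 //.
  by move/allP=> /(_ i (mem_index_enum i)).
exists (fun i => r i / \sum_j r j); split=> [i||i].
- by rewrite divr_ge0 ?sumr_ge0.
- by rewrite -mulr_suml divff.
- by rewrite mulrC divfK.
Qed.

Lemma mul_pow_onem_le (R : realFieldType) (k : nat) (x : R) :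
  (0 < k)%N -> 0 <= x <= 1 ->
  x * (1 - x) ^+ k <= k.+1%:R^-1 * (1 - k.+1%:R^-1) ^+ k.
Proof.
move=> k_gt0 /andP[x_ge0 x_le1].
have kR_gt0 : 0 < k%:R :> R by rewrite ltr0n.
have k1R_gt0 : 0 < k.+1%:R :> R by rewrite ltr0n.
(* AM-GM for the k + 1 numbers k x, 1 - x, ..., 1 - x, whose sum is k *)
pose E (i : 'I_k.+1) : R := if i == ord0 then k%:R * x else 1 - x.
have E_ge0 i : 0 <= E i.
  by rewrite /E; case: ifP; rewrite ?subr_ge0 ?mulr_ge0 // ltW.
have [+ _] := @leif_AGM R _ 'I_k.+1 E (fun i _ => E_ge0 i).
rewrite card_ord !big_ord_recl /= /E eqxx prodr_const sumr_const !card_ord.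
rewrite -[(1 - x) *+ k]mulr_natl -mulrDr subrKC mulr1 => AGM.
have -> : 1 - k.+1%:R^-1 = k%:R / k.+1%:R :> R.
  apply: (mulIf (lt0r_neq0 k1R_gt0)).
  by rewrite mulrBl mul1r mulVf ?divfK ?lt0r_neq0 // -natr1 addrK.
(* After multiplication by [k], the right side becomes [(k / (k + 1)) ^ (k + 1)], the power of the
   mean in [AGM]. *)
by rewrite -(ler_pM2l kR_gt0) mulrA [leRHS]mulrA -exprS.
Qed.

Section RandomDraws.
Variables (R : realType) (n k : nat) (P : 'I_n -> R).
Hypotheses (P_ge0 : forall i, 0 <= P i) (P_sum1 : \sum_i P i = 1).
Variable ext : {ffun 'I_k -> 'I_n} -> {set 'I_n}.
Hypotheses (sub_ext : forall t : {ffun 'I_k -> 'I_n},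
              [set t i | i : 'I_k] \subset ext t)
           (card_ext : forall t, #|ext t| == k).

Definition draw_prob (t : {ffun 'I_k -> 'I_n}) : R := \prod_i P (t i).

(** The push-forward of the product law of the draws along [ext]. *)
Definition draw_strategy : {ffun {set 'I_n} -> R} :=
  [ffun H => \sum_(t | ext t == H) draw_prob t].

Lemma draw_prob_ge0 t : 0 <= draw_prob t.
Proof. exact: prodr_ge0. Qed.

Lemma draw_strategyE (f : {set 'I_n} -> R) :
  \sum_H draw_strategy H * f H = \sum_t draw_prob t * f (ext t).
Proof.
rewrite [RHS](partition_big ext predT) //=; apply: eq_bigr => H _.
by rewrite ffunE mulr_suml; apply: eq_bigr => t /eqP ->.
Qed.

Lemma draw_strategy_mixed : mixed_strategy (hider_strategies n k) draw_strategy.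
Proof.
split=> [H|H|]; rewrite ?ffunE.
- by apply: sumr_ge0 => t _; exact: draw_prob_ge0.
- rewrite inE => cH; rewrite big_pred0 // => t.
  by apply: contraNF cH => /eqP <-.
have := draw_strategyE (fun=> 1); under eq_bigr do rewrite mulr1.
move=> ->; under eq_bigr do rewrite mulr1.
(* Summing the product law over all tuples gives [(\sum_i P i) ^ k]. *)
by rewrite -(bigA_distr_bigA (fun _ i => P i)) prodr_const P_sum1 expr1n.
Qed.

(** If [S] misses [ext t], it misses each of the [k] draws, and by independence that has probability
    [(1 - P(S)) ^ k]. Writing [1 - P(S)] as a sum of [P i] times an indicator lets the power expand
    over tuples, so the bound can be checked tuple by tuple. *)
Lemma draw_avoid_le (S : {set 'I_n}) :
  \sum_t draw_prob t * [disjoint S & ext t]%:R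
    <= (1 - \sum_(i in S) P i) ^+ k.
Proof.
have -> : 1 - \sum_(i in S) P i = \sum_i P i * (i \notin S)%:R.
  rewrite -[X in X - _]P_sum1 (bigID (mem S)) /= addrC addrK big_mkcond.
  by apply: eq_bigr => i _; case: (i \in S) => /=; rewrite ?mulr1 ?mulr0.
rewrite -[X in _ ^+ X]card_ord -prodr_const.
rewrite (bigA_distr_bigA (fun _ i => P i * (i \notin S)%:R)).
apply: ler_sum => t _; rewrite big_split /= ler_wpM2l ?draw_prob_ge0 //.
have [dis|_] := boolP [disjoint S & ext t]; last exact: prodr_ge0.
rewrite big1 // => i _; rewrite (disjointFl dis) //.
by apply: (subsetP (sub_ext t)); apply: imset_f.
Qed.

End RandomDraws.

Theorem proposition12 (R : realType) (n k : nat) (r : 'I_n -> R) (V : R)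
    (hk1 : (1 <= k)%N) (hkn : (k <= n - 1)%N)
    (r_noninc : forall i j : 'I_n, (i <= j)%N -> r j <= r i)
    (r_ge0 : forall i : 'I_n, 0 <= r i)
    (hV : is_trap_game_value k (complete_hypergraph n) r V) :
  V <= (\sum_(i < n) r i) / k.+1%:R * (1 - 1 / k.+1%:R) ^+ k.
Proof.
have le_kn : (k <= n)%N := leq_trans hkn (leq_subr 1 n).
have n_gt0 : (0 < #|'I_n|)%N by rewrite card_ord (leq_trans hk1).
have [P [P_ge0 P_sum1 rE]] := exists_weights n_gt0 r_ge0.
(* Repeated draws leave at most [k] distinct boxes, so each tuple can be completed to a [k]-set;
   finite choice collects the completions into [ext]. *)
have /fin_all_exists2[ext sub_ext card_ext] (t : {ffun 'I_k -> 'I_n}) :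
    exists2 B : {set 'I_n}, [set t i | i : 'I_k] \subset B & #|B| == k.
  apply: exists_superset_card; rewrite card_ord le_kn andbT.
  by rewrite -[X in (_ <= X)%N](card_ord k) leq_imset_card.
(* An optimal Searcher mix [p] earns at least [V] against every Hider mix, in particular against the
   random draws. *)
have [[p [p_ge0 _ p_sum1] V_le] _] := hV.
apply: le_trans (V_le _ (draw_strategy_mixed P_ge0 P_sum1 card_ext)) _.
(* Spreading the bound over the total mass 1 of [p] reduces the goal to a single pure strategy
   [S]. *)
rewrite div1r -[leRHS]mul1r -[X in _ <= X * _]p_sum1 mulr_suml; apply: ler_sum => S _.
under eq_bigr do rewrite -mulrA.
rewrite -mulr_sumr ler_wpM2l // draw_strategyE.
set x := \sum_(i in S) P i.
have x01 : 0 <= x <= 1.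
  rewrite sumr_ge0 //= -P_sum1 [leRHS](bigID (mem S)) /= lerDl.
  exact: sumr_ge0.
have -> : \sum_t draw_prob P t * trap_payoff r S (ext t)
    = (\sum_i r i) * x * \sum_t draw_prob P t * [disjoint S & ext t]%:R.
  rewrite mulr_sumr; apply: eq_bigr => t _; rewrite /trap_payoff mulrCA.
  congr (_ * _); case: ifP => _; rewrite ?mulr0 // mulr1 mulr_sumr.
  exact: eq_bigr.
rewrite -!mulrA ler_wpM2l ?sumr_ge0 //.
apply: le_trans (mul_pow_onem_le hk1 x01).
rewrite ler_wpM2l //; first by case/andP: x01.
exact: draw_avoid_le.
Qed.
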